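(* Let $q\geq 0$ and $n\geq 0$ be integers. Paul has a winning strategy for the $q$-round pathological liar game with $2$ lies and initial state $(n,0,0)$ if and only if $$2^q\leq n\binom{q}{\leq 2}-A\binom{q-1}{2}-B\binom{q-2}{1},$$ where $A=n\bmod 2$ and $$B=\begin{cases} 0 & \text{if } n\equiv 0\pmod 4,\\ 2\cdot(q\bmod 2) & \text{if } n\equiv 1\pmod 4,\\ (1-q^3)\bmod 4 & \text{if } n\equiv 2\pmod 4,\\ (1+q^3)\bmod 4 & \text{if } n\equiv 3\pmod 4.\end{cases}$$
   Context: Pathological liar game with $2$ lies: a state is a vector $(x_0,x_1,x_2)$ of nonnegative integers. In each of $q$ rounds Paul chooses a legal question $(a_0,a_1,a_2)$ with integers $0\leq a_i\leq x_i$, and Carole answers Y or N; the new state is $(a_0,\,a_1+x_0-a_0,\,a_2+x_1-a_1)$ after Y, or $(x_0-a_0,\,x_1-a_1+a_0,\,x_2-a_2+a_1)$ after N. Paul wins iff after $q$ rounds $x_0+x_1+x_2\geq 1$. Notation: $\binom{q}{\leq 2}=1+q+\binom{q}{2}$; ''$m\bmod 4$'' denotes the least nonnegative residue. *)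

(* Defs.v *)
From mathcomp Require Import all_boot all_order all_algebra.
Set Implicit Arguments. Unset Strict Implicit. Unset Printing Implicit Defensive.
Import Order.TTheory GRing.Theory Num.Theory.

Definition state := (nat * nat * nat)%type.

Definition yes_state (x : state) (a : state) : state :=
  let: (x0, x1, x2) := x in let: (a0, a1, a2) := a in
  (a0, a1 + x0 - a0, a2 + x1 - a1)%N.

Definition no_state (x : state) (a : state) : state :=
  let: (x0, x1, x2) := x in let: (a0, a1, a2) := a in
  (x0 - a0, x1 - a1 + a0, x2 - a2 + a1)%N.

Definition legal (x a : state) : Prop :=
  let: (x0, x1, x2) := x in let: (a0, a1, a2) := a in
  (a0 <= x0 /\ a1 <= x1 /\ a2 <= x2)%N.

Fixpoint paul_wins (q : nat) (x : state) : Prop :=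
  match q with
  | 0 => let: (x0, x1, x2) := x in (1 <= x0 + x1 + x2)%N
  | q'.+1 => exists a : state, legal x a /\
               paul_wins q' (yes_state x a) /\ paul_wins q' (no_state x a)
  end.

Definition binom_le2 (q : nat) : nat := (1 + q + 'C(q, 2))%N.

Definition liarA (n : nat) : int := (n %% 2)%:Z.

Definition liarB (n q : nat) : int :=
  match (n %% 4)%N with
  | 0 => 0
  | 1 => (2 * (q %% 2))%:Z
  | 2 => ((1 - (q%:Z) ^+ 3) %% 4)%Z
  | _ => ((1 + (q%:Z) ^+ 3) %% 4)%Z
  end.

(* Main.v *)
From Stdlib Require Import ZArith Lia.
Require Import Defs.
From mathcomp Require Import all_boot all_order all_algebra.
From mathcomp Require Import zify ssrZ.
Import Order.TTheory GRing.Theory Num.Theory.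

(** Give a state the weight that counts, for each chip, the answer sequences
    it survives.  Each question splits the weight between its two answers, so
    Paul needs weight at least [2 ^ q], and what he loses is due to questions
    that cannot be balanced.  As [x_2 = 0] during the first two rounds, parity
    forces losses there: [A] comes from the first question and [B] from the
    second one, since the imbalance of the latter is [(q - 2) / 2] times a
    number whose residue modulo 4 is prescribed.  This gives necessity.

    Conversely, if Paul plays the first two rounds optimally, then from there
    on he splits [x_0] and [x_1] into halves and corrects the imbalance with
    chips of [x_2].  For [q >= 40] the weight forces [x_2] to be large enough
    for that until 8 rounds are left, when [x_0 <= 1] and [x_1 <= 14]; these
    finitely many endgames, and the rounds [q < 40], are checked by running a
    greedy strategy. *)

Local Open Scope Z_scope.

#[local] Arguments Z.mul : simpl never.
#[local] Arguments Z.add : simpl never.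
#[local] Arguments Z.sub : simpl never.
#[local] Arguments Z.pow : simpl never.
#[local] Arguments Z.of_nat : simpl never.

(** * The game on integer states, and its monotonicity *)

Definition zstate := (Z * Z * Z)%type.

Definition nat_state (x : zstate) : state :=
  (Z.to_nat x.1.1, Z.to_nat x.1.2, Z.to_nat x.2).

Definition zwins (r : nat) (x : zstate) : Prop := paul_wins r (nat_state x).

Definition zyes (x a : zstate) : zstate :=
  (a.1.1, a.1.2 + x.1.1 - a.1.1, a.2 + x.1.2 - a.1.2).

Definition zno (x a : zstate) : zstate :=
  (x.1.1 - a.1.1, x.1.2 - a.1.2 + a.1.1, x.2 - a.2 + a.1.2).

Definition zlegal (x a : zstate) : bool :=
  [&& 0 <=? a.1.1, a.1.1 <=? x.1.1, 0 <=? a.1.2, a.1.2 <=? x.1.2,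
      0 <=? a.2 & a.2 <=? x.2].

(** A question stays legal when chips are added, and both of its answers preserve the domination. *)
Lemma paul_wins_mono (r x0 x1 x2 y0 y1 y2 : nat) :
  (x0 <= y0)%N -> (x1 <= y1)%N -> (x2 <= y2)%N ->
  paul_wins r (x0, x1, x2) -> paul_wins r (y0, y1, y2).
Proof.
elim: r x0 x1 x2 y0 y1 y2 => [|r IHr] x0 x1 x2 y0 y1 y2 h0 h1 h2 /=.
  by lia.
case=> [[[a0 a1] a2]] [/= [l0 [l1 l2]] [wY wN]].
exists (a0, a1, a2); split; first by rewrite /=; lia.
by split; [apply: IHr wY|apply: IHr wN]; lia.
Qed.

Lemma zwins_ask (r : nat) (x a : zstate) :
  zlegal x a -> zwins r (zyes x a) -> zwins r (zno x a) -> zwins r.+1 x.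
Proof.
case: x => [[x0 x1] x2]; case: a => [[a0 a1] a2].
rewrite /zlegal /zwins /nat_state /zyes /zno /=.
case/and5P=> h1 h2 h3 h4 /andP[h5 h6] wY wN.
exists (Z.to_nat a0, Z.to_nat a1, Z.to_nat a2); split; first by rewrite /=; lia.
by split; [apply: paul_wins_mono wY|apply: paul_wins_mono wN]; lia.
Qed.

Lemma zwins_mono (r : nat) (x0 x1 x2 y0 y1 y2 : Z) :
  x0 <= y0 -> x1 <= y1 -> x2 <= y2 ->
  zwins r (x0, x1, x2) -> zwins r (y0, y1, y2).
Proof. by move=> h0 h1 h2; apply: paul_wins_mono => /=; lia. Qed.

(** * The weight and the bound it gives *)

(* Doubled to avoid halves: [r * r + r + 2] is [2 * binom_le2 r]. *)
Definition weight (r : Z) (x : zstate) : Z :=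
  x.1.1 * (r * r + r + 2) + 2 * x.1.2 * (r + 1) + 2 * x.2.

Lemma pow2S (r : nat) : 2 ^ Z.of_nat r.+1 = 2 * 2 ^ Z.of_nat r.
Proof. by rewrite -Z.pow_succ_r; [congr (_ ^ _)|]; lia. Qed.

(** Pascal's rule: each chip stays in place after one answer and moves on by one place, or leaves
    [x_2], after the other. *)
Lemma weight_yes_no (r : Z) (x a : zstate) :
  weight r (zyes x a) + weight r (zno x a) = weight (r + 1) x.
Proof. by rewrite /weight /zyes /zno /=; ring. Qed.

Lemma weight_ge_pow (r x0 x1 x2 : nat) : paul_wins r (x0, x1, x2) ->
  2 * 2 ^ Z.of_nat r <=
  weight (Z.of_nat r) (Z.of_nat x0, Z.of_nat x1, Z.of_nat x2).
Proof.
elim: r x0 x1 x2 => [|r IHr] x0 x1 x2.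
  by rewrite /weight /= (_ : Z.of_nat 0 = 0); lia.
case=> [[[a0 a1] a2]] [[l0 [l1 l2]] [/IHr wY /IHr wN]].
rewrite pow2S [Z.of_nat r.+1](_ : _ = Z.of_nat r + 1); last by lia.
rewrite -(weight_yes_no _ _ (Z.of_nat a0, Z.of_nat a1, Z.of_nat a2)).
have -> : zyes (Z.of_nat x0, Z.of_nat x1, Z.of_nat x2)
    (Z.of_nat a0, Z.of_nat a1, Z.of_nat a2) =
  (Z.of_nat a0, Z.of_nat (a1 + x0 - a0), Z.of_nat (a2 + x1 - a1)).
  by rewrite /zyes /=; congr (_, _, _); lia.
have -> : zno (Z.of_nat x0, Z.of_nat x1, Z.of_nat x2)
    (Z.of_nat a0, Z.of_nat a1, Z.of_nat a2) =
  (Z.of_nat (x0 - a0), Z.of_nat (x1 - a1 + a0), Z.of_nat (x2 - a2 + a1)).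
  by rewrite /zno /=; congr (_, _, _); lia.
by lia.
Qed.

(** * The corrections [A] and [B] over the integers *)

Definition odd_defect (n : Z) : Z := n mod 2.

Definition mod4_defect (n q : Z) : Z :=
  match n mod 4 with
  | 0 => 0
  | 1 => 2 * (q mod 2)
  | 2 => (1 - q ^ 3) mod 4
  | _ => (1 + q ^ 3) mod 4
  end.

(* Twice the right-hand side of the theorem; the [Z.max] reproduce the
   truncated subtractions for [q < 2]. *)
Definition capacity (n q : Z) : Z :=
  n * (q * q + q + 2) - odd_defect n * (Z.max 0 (q - 1) * Z.max 0 (q - 2))
  - 2 * mod4_defect n q * Z.max 0 (q - 2).

Lemma binZ2 (m : nat) :
  2 * Z.of_nat 'C(m, 2) = Z.of_nat m * Z.max 0 (Z.of_nat m - 1).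
Proof.
have := bin_ffact m 2; rewrite ffactnSr ffactn1 (_ : 2`!%N = 2%N) // => h.
by nia.
Qed.

Lemma Z_mod4P (a : Z) : exists b c : Z,
  a = 4 * b + c /\ (c = 0 \/ c = 1 \/ c = 2 \/ c = 3).
Proof.
exists (a / 4), (a mod 4).
by have := Z.div_mod a 4; have := Z.mod_pos_bound a 4; lia.
Qed.

Lemma odd_defect_mod (n b c : Z) : n = 4 * b + c ->
  odd_defect n = odd_defect c.
Proof.
move=> ->; rewrite /odd_defect (_ : _ + c = c + (2 * b) * 2); last by ring.
exact: Z.mod_add.
Qed.

Lemma mod4_defect_mod (n q b c d e : Z) : n = 4 * b + c -> q = 4 * d + e ->
  mod4_defect n q = mod4_defect c e.
Proof.
move=> -> ->; rewrite /mod4_defect.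
(* [4 * f] is [(4 * d + e) ^ 3 - e ^ 3]. *)
set f := 16 * d ^ 3 + 12 * d ^ 2 * e + 3 * d * e ^ 2.
have -> : 1 - (4 * d + e) ^ 3 = 1 - e ^ 3 + (- f) * 4 by rewrite /f; ring.
have -> : 1 + (4 * d + e) ^ 3 = 1 + e ^ 3 + f * 4 by rewrite /f; ring.
have -> : (4 * d + e) mod 2 = e mod 2.
  by rewrite (_ : _ + e = e + (2 * d) * 2) ?Z.mod_add //; ring.
have -> : (4 * b + c) mod 4 = c mod 4.
  by rewrite (_ : _ + c = c + b * 4) ?Z.mod_add //; ring.
by rewrite !Z.mod_add.
Qed.

Lemma Z_modP (a d : Z) : 0 < d ->
  exists b, a = d * b + a mod d /\ 0 <= a mod d < d.
Proof.
move=> d_gt0; exists (a / d); split; first by apply: Z.div_mod; lia.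
exact: Z.mod_pos_bound.
Qed.

Lemma liarBE (n q : nat) :
  Z_of_int (liarB n q) = mod4_defect (Z.of_nat n) (Z.of_nat q).
Proof.
rewrite /liarB /mod4_defect.
have [a [ea ba]] := Z_modP (Z.of_nat n) 4 erefl.
have [b eb] := Z_modP (1 - Z.of_nat q ^ 3) 4 erefl.
have [c ec] := Z_modP (1 + Z.of_nat q ^ 3) 4 erefl.
have [d ed] := Z_modP (Z.of_nat q) 2 erefl.
have : (n %% 4)%N = 0%N /\ Z.of_nat n mod 4 = 0 \/
       (n %% 4)%N = 1%N /\ Z.of_nat n mod 4 = 1 \/
       (n %% 4)%N = 2%N /\ Z.of_nat n mod 4 = 2 \/
       (n %% 4)%N = 3%N /\ Z.of_nat n mod 4 = 3 by lia.
by case=> [[-> ->]|[[-> ->]|[[-> ->]|[-> ->]]]]; lia.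
Qed.

Lemma capacityE (n q : nat) :
  ((2 ^ q)%N%:Z <= (n * binom_le2 q)%N%:Z - liarA n * ('C(q - 1, 2)%N)%:Z
                   - liarB n q * ('C(q - 2, 1)%N)%:Z)%R <->
  2 * 2 ^ Z.of_nat q <= capacity (Z.of_nat n) (Z.of_nat q).
Proof.
rewrite /capacity -liarBE /liarA /odd_defect /binom_le2 bin1.
have hq := binZ2 q; have hq1 := binZ2 (q - 1).
have hp : Z.of_nat (2 ^ q)%N = 2 ^ Z.of_nat q by lia.
have [b eb] := Z_modP (Z.of_nat n) 2 erefl.
have eA : Z.of_nat n mod 2 = Z.of_nat (n %% 2)%N by lia.
have e1 : Z.max 0 (Z.of_nat q - 1) = Z.of_nat (q - 1)%N by lia.
have e2 : Z.max 0 (Z.of_nat q - 2) = Z.of_nat (q - 2)%N by lia.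
have e3 : Z.max 0 (Z.of_nat (q - 1)%N - 1) = Z.of_nat (q - 2)%N by lia.
have e4 : Z.of_nat q * Z.of_nat (q - 1)%N + Z.of_nat q =
    Z.of_nat q * Z.of_nat q by nia.
rewrite eA e1 e2 -hp; rewrite e1 in hq; rewrite e3 in hq1.
rewrite (_ : _ * _ + _ + 2 = 2 * (1 + Z.of_nat q + Z.of_nat 'C(q, 2)));
  last by lia.
rewrite -hq1.
by lia.
Qed.

Lemma mod4_defectE (n q b c d e : Z) : n = 4 * b + c -> q = 4 * d + e ->
  odd_defect n = odd_defect c /\ mod4_defect n q = mod4_defect c e.
Proof.
move=> hn hq.
by rewrite (odd_defect_mod n b c hn) (mod4_defect_mod n q b c d e hn hq).
Qed.

Lemma mod4_defect_bounds (n q : Z) :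
  0 <= odd_defect n <= 1 /\ 0 <= mod4_defect n q <= 2.
Proof.
have [b [c [hn hc]]] := Z_mod4P n; have [d [e [hq he]]] := Z_mod4P q.
have [-> ->] := mod4_defectE n q b c d e hn hq.
by case: hc => [->|[->|[->|->]]]; case: he => [->|[->|[->|->]]].
Qed.

(** * Necessity: the losses of the first two questions *)

(* The second question shifts the weight by [r/2] times a number that the
   parities of [k] and [l] force away from [0] modulo [4]. *)
Lemma weight_second_question (r k l : nat) : paul_wins r.+1 (k, l, 0%N) ->
  exists b0 b1 : Z, 4 * 2 ^ Z.of_nat r + Z.of_nat r *
    Z.abs ((2 * b0 - Z.of_nat k) * (Z.of_nat r - 1) + 2 * (2 * b1 - Z.of_nat l))
    <= weight (Z.of_nat r + 1) (Z.of_nat k, Z.of_nat l, 0).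
Proof.
case=> [[[b0 b1] b2]] [[l0 [l1 l2]] [/weight_ge_pow wY /weight_ge_pow wN]].
exists (Z.of_nat b0), (Z.of_nat b1); move: wY wN; rewrite /weight /=.
have -> : b2 = 0%N by lia.
have -> : Z.of_nat (b1 + k - b0) =
    Z.of_nat b1 + Z.of_nat k - Z.of_nat b0 by lia.
have -> : Z.of_nat (l - b1 + b0) =
    Z.of_nat l - Z.of_nat b1 + Z.of_nat b0 by lia.
have -> : Z.of_nat (0 + l - b1) = Z.of_nat l - Z.of_nat b1 by lia.
have -> : Z.of_nat (0 - 0 + b1) = Z.of_nat b1 by lia.
have -> : Z.of_nat (k - b0) = Z.of_nat k - Z.of_nat b0 by lia.
have : 0 <= Z.of_nat r by lia.
move: (Z.of_nat r) (2 ^ Z.of_nat r) (Z.of_nat b0) (Z.of_nat b1)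
  (Z.of_nat k) (Z.of_nat l).
move=> {l0 l1 l2} s p a b x y s_ge0 wY wN.
by case: (Z.abs_spec ((2 * a - x) * (s - 1) + 2 * (2 * b - y))) => [] [_ ->]; nia.
Qed.

(** If the first question is as balanced as parity allows, residues modulo 4 force the second loss.
    Otherwise the first one costs at least [2 * (r + 1) >= 4] more, which covers
    [2 * mod4_defect]. *)
Lemma defect_le (n k l r b0 b1 : Z) : 0 <= k -> l = n - k -> 1 <= r -> 2 * k <= n ->
  odd_defect n * (r + 1) + 2 * mod4_defect n (r + 2) <=
  (n - 2 * k) * (r + 1) + 2 * Z.abs ((2 * b0 - k) * (r - 1) + 2 * (2 * b1 - l)).
Proof.
move=> k_ge0 -> r_ge1 le_kn.
have [b [c [hn hc]]] := Z_mod4P n; have [d [e [hr he]]] := Z_mod4P (r + 2).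
have [a1 a2] := mod4_defect_bounds n (r + 2).
have [hk|hk] : n - 2 * k = odd_defect n \/ n - 2 * k >= odd_defect n + 2.
- have [-> _] := mod4_defectE n _ b c d e hn hr.
  by case: hc => [hc|[hc|[hc|hc]]]; rewrite hc /odd_defect /Z.modulo /=; lia.
- rewrite hk; suff : mod4_defect n (r + 2) <=
    Z.abs ((2 * b0 - k) * (r - 1) + 2 * (2 * b1 - (n - k))) by lia.
  have [eA ->] := mod4_defectE n _ b c d e hn hr.
  (* Isolating a multiple of 4 leaves a linear problem for each pair of residues. *)
  have -> : r - 1 = 4 * d + (e - 3) by lia.
  have -> : (2 * b0 - k) * (4 * d + (e - 3)) =
    4 * ((2 * b0 - k) * d) + (2 * b0 - k) * (e - 3) by ring.
  rewrite {}eA in hk; move: ((2 * b0 - k) * d) => z.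
  by case: hc hk hn => [->|[->|[->|->]]] => hk hn; 
    case: he => [->|[->|[->|->]]];
    set D := mod4_defect _ _; set A := odd_defect _ in hk;
    vm_compute in A, D; rewrite /A in hk; rewrite /D; lia.
- nia.
Qed.

Lemma capacity_ge_pow (q n : nat) : paul_wins q (n, 0%N, 0%N) ->
  2 * 2 ^ Z.of_nat q <= capacity (Z.of_nat n) (Z.of_nat q).
Proof.
case: q => [|[|r]].
- by move/weight_ge_pow; rewrite /weight /capacity /=; lia.
- by move/weight_ge_pow; rewrite /weight /capacity /=; lia.
move=> win.
(* Follow the answer that keeps at most half of the chips in [x_0], which has the smaller weight. *)
have [k [lekn wk]] : exists k : nat,
    (2 * k <= n)%N /\ paul_wins r.+1 (k, (n - k)%N, 0%N).
  case: win => [[[a0 a1] a2]] [[l0 [l1 l2]] [wY wN]].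
  have ea1 : a1 = 0%N by lia. have ea2 : a2 = 0%N by lia.
  case: (leqP (2 * a0) n) => h; [exists a0|exists (n - a0)%N]; split; [lia| |lia|].
  - by refine (paul_wins_mono r.+1 _ _ _ _ _ _ _ _ _ wY); lia.
  - by refine (paul_wins_mono r.+1 _ _ _ _ _ _ _ _ _ wN); lia.
have [b0 [b1 hw]] := weight_second_question _ _ _ wk.
(* For two rounds both corrections vanish through the factor [q - 2], whereas [defect_le] needs
   [1 <= r]. *)
have [r0|r_gt0] := posnP r.
  have := weight_ge_pow _ _ _ _ win; rewrite r0 /weight /capacity /=; lia.
have := defect_le (Z.of_nat n) (Z.of_nat k) (Z.of_nat (n - k)) (Z.of_nat r) b0 b1.
rewrite !pow2S /capacity (_ : Z.of_nat r.+2 = Z.of_nat r + 2); last by lia.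
move: hw; rewrite /weight /=; move: (Z.abs _) => z.
have -> : Z.of_nat (n - k) = Z.of_nat n - Z.of_nat k by lia.
move: (mod4_defect _ _) (odd_defect _) => B A.
rewrite !Z.max_r; [|lia..].
move=> hw hd; have {}hd := hd ltac:(lia) ltac:(lia) ltac:(lia) ltac:(lia).
move: (Z.mul_le_mono_nonneg_l _ _ (Z.of_nat r) ltac:(lia) hd).
lia.
Qed.

(** * A greedy strategy that can be run *)

Definition clamp (b z : Z) : Z := Z.max (- b) (Z.min b z).

(* A question [a] is encoded by its imbalances [2 a_i - x_i]; with [s] rounds
   left after it, the two answers differ in weight by
   [s (s - 1) / 2, s, 1] times these.  Given the imbalance [u] of [x_0], the
   other two are chosen one after the other to bring the sum close to [0]. *)
Definition imbalances (s : Z) (x : zstate) (u : Z) : zstate :=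
  let c := u * (s * (s - 1) / 2) in
  let t := - (c / s) in
  let v := clamp x.1.2 (t + (t + x.1.2) mod 2) in
  let d := - (c + v * s) in
  (u, v, clamp x.2 (d + (d + x.2) mod 2)).

Definition imbalance (s : Z) (u : zstate) : Z :=
  Z.abs (u.1.1 * (s * (s - 1) / 2) + u.1.2 * s + u.2).

(* On the three listed states, which arise for 52 chips and 12 rounds, the
   greedy choice loses. *)
Definition ask (s : Z) (x : zstate) : zstate :=
  match x with
  | (7, 17, 22) => (3, 11, 5)
  | (3, 14, 19) => (1, 9, 6)
  | (1, 11, 11) => (0, 7, 4)
  | _ =>
    let p := x.1.1 mod 2 in
    let u := imbalances s x p in
    let u' := imbalances s x (p + 2) in
    let: (u0, u1, u2) :=
      if (p + 2 <=? x.1.1) && (imbalance s u' <? imbalance s u) then u' else u in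
    ((x.1.1 + u0) / 2, (x.1.2 + u1) / 2, (x.2 + u2) / 2)
  end.

(* Few distinct states occur at each depth, so the game tree is explored
   breadth first, with duplicates removed. *)
Fixpoint ask_wins (r : nat) (L : seq zstate) : bool :=
  match r with
  | 0%N => all (fun x => 1 <=? x.1.1 + x.1.2 + x.2) L
  | s.+1 =>
    let sz := Z.of_nat s in
    all (fun x => zlegal x (ask sz x)) L &&
    ask_wins s (undup ([seq zyes x (ask sz x) | x <- L] ++
                       [seq zno x (ask sz x) | x <- L]))
  end.

Lemma ask_wins_sound (r : nat) (L : seq zstate) (x : zstate) :
  ask_wins r L -> x \in L -> zwins r x.
Proof.
elim: r L x => [|s IHs] L x /=.
  move=> /allP wL /wL; case: x => [[x0 x1] x2]; rewrite /zwins /nat_state /=.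
  by lia.
case/andP=> /allP lL wL xL; apply: (zwins_ask s x (ask (Z.of_nat s) x)).
- exact: lL.
- by apply: IHs wL _; rewrite mem_undup mem_cat; apply/orP; left; apply/mapP; exists x.
- by apply: IHs wL _; rewrite mem_undup mem_cat; apply/orP; right; apply/mapP; exists x.
Qed.

(** * Finite checks: fewer than 40 rounds, and the last 8 rounds *)

Definition least_size (q : Z) : Z :=
  let t := q * q + q + 2 in (2 * 2 ^ q + t - 1) / t.

(** Below [m] the weight is too small, and the win at [m + 3] passes to all larger sizes by
    monotonicity, so four runs settle every [n]. *)
Definition small_ok (q : nat) : bool :=
  let qz := Z.of_nat q in
  let m := least_size qz in
  all (fun n => (2 * 2 ^ qz <=? capacity n qz) ==> ask_wins q [:: (n, 0, 0)])
      [:: m; m + 1; m + 2]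
  && ask_wins q [:: (m + 3, 0, 0)].

Lemma small_ok_lt40 : all small_ok (iota 0 40).
Proof. by vm_compute. Qed.

(** The states of weight exactly [2 ^ 8] with 8 rounds left: [37] is [binom_le2 8] and [9] is
    [1 + 8]. *)
Definition end_states : seq zstate :=
  [seq (x0, x1, 256 - 37 * x0 - 9 * x1) |
    x0 <- [:: 0; 1], x1 <- [seq Z.of_nat i | i <- iota 0 15]].

Lemma end_states_win : ask_wins 8 end_states.
Proof. by vm_compute. Qed.

(** The corrections cost less than the weight of two chips, so only a few sizes near
    [2 * 2 ^ q / (q * q + q + 2)] are delicate. *)
Lemma capacity_le (n q : Z) : 0 <= q ->
  n * (q * q + q + 2) - (q * q + q + 2) - 2 * q <= capacity n q <= n * (q * q + q + 2).
Proof.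
move=> q_ge0; rewrite /capacity; have := mod4_defect_bounds n q.
move: (odd_defect n) (mod4_defect n q) => A B [hA hB].
have h2 : 0 <= Z.max 0 (q - 2) <= q by lia.
have h1 : 0 <= Z.max 0 (q - 1) * Z.max 0 (q - 2) <= q * q - 3 * q + 2.
  have [h|h] : q - 2 <= 0 \/ 0 <= q - 2 by lia.
    by rewrite (Z.max_l 0 (q - 2)); nia.
  by rewrite !Z.max_r; nia.
split; nia.
Qed.

Lemma zwins_lt40 (q : nat) (n : Z) : (q < 40)%N ->
  2 * 2 ^ Z.of_nat q <= capacity n (Z.of_nat q) -> zwins q (n, 0, 0).
Proof.
move=> lt_q hn.
have /allP/(_ q) := small_ok_lt40; rewrite mem_iota => /(_ lt_q).
rewrite /small_ok; set m := least_size _; case/andP=> /allP small big.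
have m_le : m <= n.
  have [_ hc] := capacity_le n (Z.of_nat q) ltac:(lia).
  rewrite /m /least_size; move: hn hc; set t := (_ * _ + _ + 2) => hn hc.
  have t_gt0 : 0 < t by rewrite /t; nia.
  have := Z.mul_div_le (2 * 2 ^ Z.of_nat q + t - 1) t t_gt0.
  move: (_ / t) => d hd; nia.
have small' i : i \in [:: m; m + 1; m + 2] -> i = n -> zwins q (n, 0, 0).
  move=> /small wi ei; move: wi; rewrite ei => /implyP wn.
  apply: ask_wins_sound (wn _) _; last by rewrite mem_seq1.
  by lia.
have [e|[e|[e|h]]] : m = n \/ m + 1 = n \/ m + 2 = n \/ m + 3 <= n by lia.
- by apply: small' e; rewrite !inE eqxx.
- by apply: small' e; rewrite !inE eqxx !orbT.
- by apply: small' e; rewrite !inE eqxx !orbT.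
- apply: (zwins_mono q (m + 3) 0 0) => //.
  by apply: ask_wins_sound big _; rewrite mem_seq1.
Qed.

Lemma zwins_end (x0 x1 x2 : Z) : 0 <= x0 <= 1 -> 0 <= x1 <= 14 ->
  2 * 2 ^ 8 <= weight 8 (x0, x1, x2) -> zwins 8 (x0, x1, x2).
Proof.
move=> h0 h1; rewrite /weight /= => hw.
apply: (zwins_mono 8 x0 x1 (256 - 37 * x0 - 9 * x1)); [lia..|].
apply: ask_wins_sound end_states_win _.
apply/allpairsP; exists (x0, x1); split=> //.
- by have [->|->] : x0 = 0 \/ x0 = 1 by lia.
- by apply/mapP; exists (Z.to_nat x1); rewrite ?mem_iota /=; lia.
Qed.

(** * Growth estimates for long games *)

Lemma pow2_ge_quartic (k : nat) : (32 <= k)%N ->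
  1000 * (Z.of_nat k + 8) ^ 4 <= 2 ^ Z.of_nat k.
Proof.
elim: k => // k IHk; rewrite leq_eqVlt => /orP[/eqP <-|]; first by vm_compute.
move=> ge32; have {}IHk := IHk ge32; rewrite pow2S.
have -> : Z.of_nat k.+1 + 8 = (Z.of_nat k + 8) + 1 by lia.
have y_ge : 40 <= Z.of_nat k + 8 by lia.
move: (2 ^ Z.of_nat k) (Z.of_nat k + 8) IHk y_ge => p y hp y_ge.
have y2 : 40 * y <= y ^ 2 by nia.
have y3 : 40 * y ^ 2 <= y ^ 3 by nia.
have y4 : 40 * y ^ 3 <= y ^ 4 by nia.
have -> : (y + 1) ^ 4 = y ^ 4 + 4 * y ^ 3 + 6 * y ^ 2 + 4 * y + 1 by ring.
lia.
Qed.

(* What makes [many_singles] below applicable when [p = 2 ^ r]. *)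
Definition growth_le (j r p : Z) : Prop :=
  let q := j + r in let t := q * q + q + 2 in
  t * (7 * t + 16 * q * (r + 1) + 2 * 2 ^ j * (r * r + 3 * r + 4)) <=
  2 * 2 ^ j * p * (j * (j - 1)).

(** One more round doubles the right side, while the two factors on the left grow by at most [11/10]
    and [13/10], whose product is below 2. *)
Lemma growth_step (j r p : Z) : 2 <= j -> 8 <= r -> 40 <= j + r ->
  growth_le j r p -> growth_le j (r + 1) (2 * p).
Proof.
rewrite /growth_le => j_ge r_ge q_ge.
have -> : j + (r + 1) = j + r + 1 by ring.
move: (j + r) q_ge (Z.pow_nonneg 2 j ltac:(lia)) => q q_ge.
move: (2 ^ j) => P P_ge0.
set t := q * q + q + 2; set t' := (q + 1) * (q + 1) + (q + 1) + 2.
set F := 7 * t + _ + _; set F' := 7 * t' + _ + _.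
have t_gt0 : 0 < t by rewrite /t; nia.
have t'_gt0 : 0 < t' by rewrite /t'; nia.
have ht : 10 * t' <= 11 * t by rewrite /t /t'; nia.
have hg : 10 * ((r + 1) * (r + 1) + 3 * (r + 1) + 4) <= 13 * (r * r + 3 * r + 4).
  by nia.
have hq : 10 * ((q + 1) * (r + 1 + 1)) <= 13 * (q * (r + 1)) by nia.
have F_ge0 : 0 <= F by rewrite /F; nia.
have F'_ge0 : 0 <= F' by rewrite /F'; nia.
have hF : 10 * F' <= 13 * F.
  have := Z.mul_le_mono_nonneg_l _ _ P P_ge0 hg; rewrite /F /F'; lia.
have : 100 * (t' * F') <= 143 * (t * F).
  have := Z.mul_le_mono_nonneg (10 * t') (11 * t) (10 * F') (13 * F)
    ltac:(lia) ht ltac:(lia) hF.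
  lia.
have : 0 <= t * F by nia.
lia.
Qed.

Lemma growth_base : all (fun j =>
  let j := Z.of_nat j in let r := 40 - j in
  let t := 40 * 40 + 40 + 2 in
  t * (7 * t + 16 * 40 * (r + 1) + 2 * 2 ^ j * (r * r + 3 * r + 4)) <=?
  2 * 2 ^ j * 2 ^ r * (j * (j - 1))) (iota 2 31).
Proof. by vm_compute. Qed.

(** The induction on [r] starts on the line [j + r = 40], which is computed, or at [r = 8] with
    [j >= 32], where [2 ^ j] beats every polynomial involved. *)
Lemma growth (j r : nat) : (2 <= j)%N -> (8 <= r)%N -> (40 <= j + r)%N ->
  growth_le (Z.of_nat j) (Z.of_nat r) (2 ^ Z.of_nat r).
Proof.
move=> j_ge; elim: r => // r IHr r_ge q_ge.
have [h|[h|h]] : (8 <= r)%N /\ (40 <= j + r)%N \/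
   r.+1 = 8%N /\ (32 <= j)%N \/ (j + r.+1 = 40)%N /\ (j <= 32)%N by lia.
- rewrite pow2S (_ : Z.of_nat r.+1 = Z.of_nat r + 1); last by lia.
  by case: h => h1 h2; apply: growth_step; [lia..|apply: IHr].
- case: h => -> j32; have := pow2_ge_quartic _ j32.
  rewrite /growth_le (_ : Z.of_nat 8 = 8) //.
  have : 32 <= Z.of_nat j by lia.
  move: (Z.of_nat j) => k k_ge; move: (2 ^ k) => P.
  rewrite (_ : 2 ^ 8 = 256) // => hP.
  set t := (k + 8) * (k + 8) + _ + 2.
  have t_gt0 : 0 < t by rewrite /t; nia.
  (* For [r = 8] the bracket is [7 * t + 144 * (k + 8) + 184 * P]; [h2] bounds it by [200 * P]. *)
  have h1 : 200 * t <= 512 * (k * (k - 1)) by rewrite /t; nia.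
  have h2 : 7 * t + 144 * (k + 8) <= 16 * P.
    have : (k + 8) ^ 2 <= (k + 8) ^ 4 by apply: Z.pow_le_mono_r; lia.
    have : 40 * (k + 8) <= (k + 8) * (k + 8) by nia.
    rewrite /t Z.pow_2_r; move: hP; have : 40 <= k + 8 by lia.
    move: (k + 8) => y; move: (y ^ 4) (y * y) => y4 y2.
    by lia.
  have P_gt0 : 0 < P by nia.
  have := Z.mul_le_mono_nonneg_l _ _ P ltac:(lia) h1.
  have := Z.mul_le_mono_nonneg_l _ _ t ltac:(lia) h2.
  lia.
- case: h => h1 h2; have /allP/(_ j) := growth_base; rewrite mem_iota.
  have -> : (2 <= j < 2 + 31)%N by lia.
  move=> /(_ isT) /=; rewrite /growth_le.
  have -> : Z.of_nat j + Z.of_nat r.+1 = 40 by lia.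
  have -> : Z.of_nat r.+1 = 40 - Z.of_nat j by lia.
  lia.
Qed.

(** * Halving until 8 rounds are left *)

Lemma Z_halfP (a : Z) : exists b e, 2 * b = a + e /\ 0 <= e <= 1.
Proof.
have [b hb] := Z_modP (- a) 2 erefl.
by exists (- b), ((- a) mod 2); lia.
Qed.

Lemma half_pronic (s : Z) : exists c, s * s = 2 * c + s.
Proof.
have [b [e [hb he]]] := Z_halfP s.
have [->|->] : s = 2 * b \/ s = 2 * b - 1 by lia.
- by exists (b * (2 * b - 1)); ring.
- by exists ((2 * b - 1) * (b - 1)); ring.
Qed.

(** Rounding the halves of [x_0] and [x_1] up creates an imbalance between 0 and [s * (s + 1) / 2],
    which [x_2] can cancel up to a parity [e]. That remainder is harmless because [weight] is
    even. *)
Lemma halving_question (s p x0 x1 x2 : Z) :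
  0 <= s -> 0 <= x0 -> 0 <= x1 -> s * s + s <= 2 * x2 ->
  4 * p <= weight (s + 1) (x0, x1, x2) ->
  exists a : zstate, zlegal (x0, x1, x2) a /\
  forall y, y = zyes (x0, x1, x2) a \/ y = zno (x0, x1, x2) a ->
    [/\ 2 * p <= weight s y, 2 * y.1.1 <= x0 + 1 & 2 * y.1.2 <= x1 + x0 + 2].
Proof.
move=> s_ge0 x0_ge0 x1_ge0 x2_ge hw.
have [a0 [u [ha0 hu]]] := Z_halfP x0; have [a1 [v [ha1 hv]]] := Z_halfP x1.
have [c hc] := half_pronic s.
have c_ge0 : 0 <= c by nia.
have d_bounds : 0 <= u * c + v * s <= c + s by nia.
have [a2 [e [ha2 he]]] := Z_halfP (x2 - (u * c + v * s)).
have d_eq : u * c + v * s = x2 + e - 2 * a2 by lia.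
exists (a0, a1, a2); split.
  by apply/and5P; split; [..|apply/andP; split] => /=; lia.
have eN : weight s (zno (x0, x1, x2) (a0, a1, a2)) =
    2 * ((x0 - a0) * (c + s + 1) + (x1 - a1 + a0) * (s + 1) + (x2 - a2 + a1)).
  by rewrite /weight /= hc; ring.
have eY : weight s (zyes (x0, x1, x2) (a0, a1, a2)) =
    2 * (a0 * (c + s + 1) + (a1 + x0 - a0) * (s + 1) + (a2 + x1 - a1)).
  by rewrite /weight /= hc; ring.
have diff : weight s (zyes (x0, x1, x2) (a0, a1, a2)) =
    weight s (zno (x0, x1, x2) (a0, a1, a2)) + 2 * e.
  rewrite eN eY; have -> : x0 = 2 * a0 - u by lia.
  have -> : x1 = 2 * a1 - v by lia.
  have -> : x2 = 2 * a2 + (u * c + v * s) - e by lia.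
  by ring.
have := weight_yes_no s (x0, x1, x2) (a0, a1, a2).
by move=> hs y [] ->; split; rewrite /=; lia.
Qed.

(* Here [q = j + r] is the total number of rounds, [P = 2 ^ j], [R = 2 ^ r]. *)
Lemma many_singles (j r m P R x0 x1 x2 : Z) :
  0 < P -> 0 <= j -> 0 <= r ->
  let q := j + r in let t := q * q + q + 2 in
  m * t <= 2 * P * R + 7 * t ->
  P * (x0 - 1) <= m -> P * (x1 - 3) <= j * m + 8 * q ->
  2 * R <= weight r (x0, x1, x2) ->
  t * (7 * t + 16 * q * (r + 1) + 2 * P * (r * r + 3 * r + 4)) <=
    2 * P * R * (j * (j - 1)) ->
  r * r - r <= 2 * x2.
Proof.
move=> P_gt0 j_ge0 r_ge0 q t hm h0 h1 hw hg.
have [//|lt_x2] : r * r - r <= 2 * x2 \/ 2 * x2 < r * r - r by lia.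
have t_gt0 : 0 < t by rewrite /t /q; nia.
have jj_ge0 : 0 <= j * (j - 1) by clear -j_ge0; nia.
set z := r * r + r + 2 in hw *.
(* With [x_0] about [m / P] and [x_1] about [j * m / P], these chips weigh about [m / P] times
   [t - j * (j - 1)]; the missing [j * (j - 1)] is the share of [x_2]. *)
have split_t : t - j * (j - 1) = z + 2 * j * (r + 1) by rewrite /t /q /z; ring.
have c_ge0 : 0 <= t - j * (j - 1) by rewrite split_t /z; nia.
have k0 : P * x0 * z <= (m + P) * z.
  by apply: Z.mul_le_mono_nonneg_r; [clear -r_ge0; nia|lia].
have k1 : P * x1 * (r + 1) <= (j * m + 8 * q + 3 * P) * (r + 1).
  by apply: Z.mul_le_mono_nonneg_r; lia.
have k2 : P * (2 * x2) < P * (r * r - r) by apply: Zmult_lt_compat_l.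
have kw : P * (2 * R) <= P * (x0 * z + 2 * x1 * (r + 1) + 2 * x2).
  by apply: Z.mul_le_mono_nonneg_l; [lia|exact: hw].
have k : 2 * P * R < m * (t - j * (j - 1)) + 16 * q * (r + 1)
    + 2 * P * (r * r + 3 * r + 4).
  by rewrite split_t; move: k0 k1 k2 kw; rewrite /z; lia.
have km : m * t * (t - j * (j - 1)) <= (2 * P * R + 7 * t) * (t - j * (j - 1)).
  exact: Z.mul_le_mono_nonneg_r.
rewrite -Z.add_assoc in k; rewrite -Z.add_assoc in hg.
move: (Zmult_lt_compat_l _ _ _ t_gt0 k) km hg.
have := Z.mul_nonneg_nonneg _ _ (Z.lt_le_incl _ _ t_gt0) jj_ge0.
move: (j * (j - 1)) (2 * P * R) (16 * _ * _ + _) => jj X G.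
by clear; lia.
Qed.

(** As [m] is at most about [512 * P / t], it is less than [P], and [(q - 8) * m] is at most about
    [11 * P]; the error terms stay below [15 * q < P]. *)
Lemma end_bounds (q m P x0 x1 : Z) : 40 <= q -> 1000 * q ^ 4 <= P ->
  let t := q * q + q + 2 in
  m * t <= 2 * P * 2 ^ 8 + 7 * t ->
  P * (x0 - 1) <= m -> P * (x1 - 3) <= (q - 8) * m + 8 * q ->
  x0 <= 1 /\ x1 <= 14.
Proof.
move=> q_ge hP t; rewrite (_ : 2 ^ 8 = 256) // => hm h0 h1.
have t_ge : 1642 <= t by rewrite /t; nia.
have P_ge : 15 * q < P.
  have : q ^ 1 <= q ^ 4 by apply: Z.pow_le_mono_r; lia.
  by rewrite Z.pow_1_r; lia.
have jt : 512 * (q - 8) <= 11 * t by rewrite /t; nia.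
clearbody t.
split.
- have [//|x0_ge] : x0 <= 1 \/ 1 <= x0 - 1 by lia.
  have hPm : P <= m by nia.
  have : P * t <= m * t by apply: Z.mul_le_mono_nonneg_r; lia.
  have : 15 * t <= P * t by apply: Z.mul_le_mono_nonneg_r; lia.
  have : P * 1642 <= P * t by apply: Z.mul_le_mono_nonneg_l; lia.
  by lia.
- have [//|x1_ge] : x1 <= 14 \/ 12 <= x1 - 3 by lia.
  have h12 : P * 12 <= (q - 8) * m + 8 * q.
    by apply: Z.le_trans h1; apply: Z.mul_le_mono_nonneg_l; lia.
  have k1 : P * 12 * t <= ((q - 8) * m + 8 * q) * t.
    by apply: Z.mul_le_mono_nonneg_r; lia.
  have k2 : (q - 8) * (m * t) <= (q - 8) * (2 * P * 256 + 7 * t).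
    by apply: Z.mul_le_mono_nonneg_l; lia.
  have k3 : P * (512 * (q - 8)) <= P * (11 * t).
    by apply: Z.mul_le_mono_nonneg_l; lia.
  have k4 : 15 * q * t < P * t by apply: Zmult_lt_compat_r; lia.
  by lia.
Qed.

(** Repeated halving makes [x_0] about [m / 2 ^ j] and [x_1] about [j * m / 2 ^ j]. The shifts 1 and
    3 absorb exactly the roundings of [halving_question]. *)
Lemma zwins_descent (q : nat) (m : Z) : (40 <= q)%N ->
  let t := Z.of_nat q * Z.of_nat q + Z.of_nat q + 2 in
  m * t <= 2 * 2 ^ Z.of_nat q + 7 * t ->
  forall r j : nat, (j + r)%N = q -> (8 <= r)%N -> (2 <= j)%N ->
  forall x0 x1 x2 : Z, 0 <= x0 -> 0 <= x1 ->
  2 ^ Z.of_nat j * (x0 - 1) <= m ->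
  2 ^ Z.of_nat j * (x1 - 3) <= Z.of_nat j * m + 8 * Z.of_nat q ->
  2 * 2 ^ Z.of_nat r <= weight (Z.of_nat r) (x0, x1, x2) ->
  zwins r (x0, x1, x2).
Proof.
move=> q_ge t hm; elim=> // r IHr j ejr r_ge j_ge x0 x1 x2 x0_ge0 x1_ge0 h0 h1 hw.
have pq : 2 ^ Z.of_nat q = 2 ^ Z.of_nat j * 2 ^ Z.of_nat r.+1.
  by rewrite -Z.pow_add_r; [congr (_ ^ _)|..]; lia.
have P_gt0 : 0 < 2 ^ Z.of_nat j by apply: Z.pow_pos_nonneg; lia.
have eq_q : Z.of_nat q = Z.of_nat j + Z.of_nat r.+1 by lia.
rewrite pq Z.mul_assoc in hm.
have [r7|r_ge8] : r = 7%N \/ (8 <= r)%N by lia.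
  move: hw ejr eq_q hm; rewrite r7 (_ : Z.of_nat 8 = 8) // => hw ejr eq_q hm.
  have [] := end_bounds (Z.of_nat q) m (2 ^ Z.of_nat j) x0 x1 _ _ hm h0 _.
  - by lia.
  - by have := pow2_ge_quartic j ltac:(lia); rewrite eq_q.
  - by rewrite {1}eq_q (_ : _ + 8 - 8 = Z.of_nat j) //; ring.
  - by move=> ? ?; apply: zwins_end.
have x2_ge : Z.of_nat r.+1 * Z.of_nat r.+1 - Z.of_nat r.+1 <= 2 * x2.
  apply: (many_singles (Z.of_nat j) _ m (2 ^ Z.of_nat j) (2 ^ Z.of_nat r.+1) x0 x1) => //.
  - by lia.
  - by lia.
  - by rewrite -eq_q.
  - by have := growth j r.+1 ltac:(lia) r_ge ltac:(lia).
have er : Z.of_nat r.+1 = Z.of_nat r + 1 by lia.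
have [a [la wa]] := halving_question (Z.of_nat r) (2 ^ Z.of_nat r) x0 x1 x2
  ltac:(lia) x0_ge0 x1_ge0 ltac:(nia) ltac:(move: hw; rewrite pow2S er; lia).
have wins_child y : y = zyes (x0, x1, x2) a \/ y = zno (x0, x1, x2) a ->
    0 <= y.1.1 -> 0 <= y.1.2 -> zwins r y.
  move=> /wa; case: y => [[y0 y1] y2] /= [hwy hy0 hy1] y0_ge0 y1_ge0.
  have i0 : 2 ^ Z.of_nat j.+1 * (y0 - 1) <= m.
    by rewrite pow2S; move: (2 ^ Z.of_nat j) P_gt0 h0 => P *; nia.
  have i1 : 2 ^ Z.of_nat j.+1 * (y1 - 3) <= Z.of_nat j.+1 * m + 8 * Z.of_nat q.
    have -> : Z.of_nat j.+1 = Z.of_nat j + 1 by lia.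
    rewrite Z.pow_add_r; [|lia..]; rewrite Z.pow_1_r.
    have := Z.mul_le_mono_nonneg_l _ _ _ (Z.lt_le_incl _ _ P_gt0) hy1.
    by move: h0 h1; lia.
  by apply: (IHr j.+1) => //; lia.
move: la; rewrite /zlegal; case: a wa wins_child => [[a0 a1] a2] wa wins_child.
move=> la; apply: (zwins_ask _ _ _ la); apply: wins_child; [by left| | |by right|..];
  by move: la => /= /and5P[? ? ? ? _]; lia.
Qed.

(** * The first two rounds of a long game *)

Lemma second_question_wins (r : nat) (n k l b0 b1 : Z) : (38 <= r)%N ->
  let q := Z.of_nat r + 2 in let t := q * q + q + 2 in
  (n - 3) * t <= 2 * (4 * 2 ^ Z.of_nat r) ->
  k + l = n -> 2 * k <= n + 1 -> 0 <= b0 <= k -> 0 <= b1 <= l ->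
  -2 <= 2 * b0 - k <= 2 -> - q <= 2 * b1 - l <= q ->
  8 * 2 ^ Z.of_nat r + 2 * Z.of_nat r *
    Z.abs ((2 * b0 - k) * (Z.of_nat r - 1) + 2 * (2 * b1 - l)) <=
  2 * weight (Z.of_nat r + 1) (k, l, 0) ->
  zwins r.+1 (k, l, 0).
Proof.
move=> r_ge q t hn ekl k_le hb0 hb1 hu hv hw.
have eq_q : Z.of_nat r.+2 = q by rewrite /q; lia.
have win y : y = zyes (k, l, 0) (b0, b1, 0) \/ y = zno (k, l, 0) (b0, b1, 0) ->
    zwins r y.
  move=> hy.
  have [y0_ge0 y1_ge0 y0_le y1_le wy] : [/\ 0 <= y.1.1, 0 <= y.1.2,
      4 * (y.1.1 - 1) <= n + 4, 4 * (y.1.2 - 3) <= 2 * (n + 4) + 8 * q &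
      2 * 2 ^ Z.of_nat r <= weight (Z.of_nat r) y].
    move: hw hy; have : 0 <= Z.of_nat r by lia.
    rewrite /weight; move: (2 ^ _) => p s_ge0 hw.
    have := Z.abs_spec ((2 * b0 - k) * (Z.of_nat r - 1) + 2 * (2 * b1 - l)).
    move: (Z.abs _) hw => z hw hz.
    have zr1 : Z.of_nat r * ((2 * b0 - k) * (Z.of_nat r - 1) + 2 * (2 * b1 - l)) <=
        Z.of_nat r * z.
      by apply: Z.mul_le_mono_nonneg_l; lia.
    have zr2 : Z.of_nat r * - ((2 * b0 - k) * (Z.of_nat r - 1) + 2 * (2 * b1 - l)) <=
        Z.of_nat r * z.
      by apply: Z.mul_le_mono_nonneg_l; lia.
    by case=> ->; split; rewrite /= ?/q; move: hw zr1 zr2; rewrite /=; lia.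
  case: y hy y0_ge0 y1_ge0 y0_le y1_le wy => [[y0 y1] y2] /= _.
  move=> y0_ge0 y1_ge0 y0_le y1_le wy.
  (* The descent starts at [j = 2] with [m = n + 4]; the 4 absorbs roundings, and [7 * t] is the
     distance from [n - 3] to [n + 4]. *)
  have hm : (n + 4) * t <= 2 * 2 ^ Z.of_nat r.+2 + 7 * t
    by rewrite !pow2S; lia.
  rewrite eq_q in hm.
  have := zwins_descent r.+2 (n + 4); rewrite eq_q => /(_ r_ge hm r 2%N); apply=> //.
  by lia.
apply: (zwins_ask _ _ (b0, b1, 0)); [|by apply: win; left|by apply: win; right].
by apply/and5P; split; [..|apply/andP; split] => /=; lia.
Qed.

(** The loss forced by [defect_le] is attained: [v] is taken near [- u * (r - 1) / 2], within its
    parity class. *)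
Lemma second_imbalances (r n k : Z) : 0 <= r -> n - 2 * k = odd_defect n ->
  exists b0 b1 : Z, let u := 2 * b0 - k in let v := 2 * b1 - (n - k) in
  [/\ -2 <= u <= 2, - (r + 2) <= v <= r + 2 &
      Z.abs (u * (r - 1) + 2 * v) <= mod4_defect n (r + 2)].
Proof.
move=> r_ge0.
have [b [c [hn hc]]] := Z_mod4P n; have [d [e [hr he]]] := Z_mod4P (r + 2).
have [-> ->] := mod4_defectE n _ b c d e hn hr.
have -> : r - 1 = 4 * d + (e - 3) by lia.
case: hc hn => [->|[->|[->|->]]] hn;
  set A := odd_defect _; vm_compute in A; rewrite /A => hk.
- have -> : k = 2 * b by lia.
  exists b, b; set D := mod4_defect 0 _ => /=.
  have : D = 0 by rewrite /D; case: he => [->|[->|[->|->]]].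
  by split; lia.
- have -> : k = 2 * b by lia.
  (* For even [q], [u = 2] and an odd [v] cancel completely; for odd [q], [u = 0] and [v = 1] leave
     2. *)
  case: he hr => [->|[->|[->|->]]] hr;
    set D := mod4_defect _ _; vm_compute in D; rewrite /D.
  + by exists (b + 1), (b - 2 * d + 2); split; lia.
  + by exists b, (b + 1); split; lia.
  + by exists (b + 1), (b - 2 * d + 1); split; lia.
  + by exists b, (b + 1); split; lia.
- have -> : k = 2 * b + 1 by lia.
  (* Here [u = 1] and [v = 1 - 2 * d], so the multiples of [d] cancel and [e - 1] remains. *)
  exists (b + 1), (b - d + 1).
  by case: he hr => [->|[->|[->|->]]] hr; set D := mod4_defect _ _; vm_compute in D;
    rewrite /D; split; lia.
- have -> : k = 2 * b + 1 by lia.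
  case: he hr => [->|[->|[->|->]]] hr;
    set D := mod4_defect _ _; vm_compute in D; rewrite /D.
  + by exists (b + 1), (b - d + 2); split; lia.
  + by exists (b + 1), (b - d + 2); split; lia.
  + by exists (b + 1), (b - d + 1); split; lia.
  + by exists (b + 1), (b - d + 1); split; lia.
Qed.

(** Enough for the other answer when [n] is odd: its extra chip in [x_0] adds [r * (r + 1)] to
    [weight], which pays for an imbalance of 2. *)
Lemma second_imbalances_coarse (r k l : Z) : 0 <= r ->
  exists b0 b1 : Z, let u := 2 * b0 - k in let v := 2 * b1 - l in
  [/\ -2 <= u <= 2, - (r + 2) <= v <= r + 2 & Z.abs (u * (r - 1) + 2 * v) <= 2].
Proof.
move=> r_ge0; have [b0 [u [hb0 hu]]] := Z_halfP k.
have [h [f [hf f_bd]]] := Z_halfP (- (u * (r - 1))).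
have [b1 [g [hg g_bd]]] := Z_halfP (l + h - 1).
exists b0, b1 => /=; have [eu|eu] : u = 0 \/ u = 1 by lia.
- by rewrite eu in hf hb0 *; split; nia.
- by rewrite eu in hf hb0 *; split; nia.
Qed.

Lemma zwins_ge40 (r : nat) (n : Z) : (38 <= r)%N ->
  let q := Z.of_nat r + 2 in let t := q * q + q + 2 in
  (n - 3) * t <= 2 * 2 ^ q -> 2 * 2 ^ q <= capacity n q ->
  zwins r.+2 (n, 0, 0).
Proof.
move=> r_ge q t; have p4 : 2 ^ q = 4 * 2 ^ Z.of_nat r.
  by rewrite /q Z.pow_add_r; lia.
rewrite p4 => n_le n_cap.
have [_ cap_le] := capacity_le n q ltac:(rewrite /q; lia).
have t_gt0 : 0 < t by rewrite /t /q; nia.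
(* This makes the second questions legal, as [v] may be as large as [q] in absolute value. *)
have n_ge : 6 * q <= n.
  have [//|lt_n] : 6 * q <= n \/ n < 6 * q by lia.
  have : n * t < 6 * q * t by apply: Zmult_lt_compat_r.
  have := pow2_ge_quartic r ltac:(lia).
  have : 40 <= q by rewrite /q; lia.
  have -> : Z.of_nat r + 8 = q + 6 by rewrite /q; ring.
  move: n_cap cap_le; rewrite /t; clear; move: (2 ^ _) (capacity _ _) => p c.
  move: q => y hc1 hc2 y_ge hp hn.
  have y2 : 40 * y <= y ^ 2 by nia.
  have y3 : 40 * y ^ 2 <= y ^ 3 by nia.
  have y4 : 40 * y ^ 3 <= y ^ 4 by nia.
  have : y ^ 4 <= (y + 6) ^ 4 by apply: Z.pow_le_mono_l; lia.
  have : 6 * y * (y * y + y + 2) = 6 * y ^ 3 + 6 * y ^ 2 + 12 * y by ring.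
  by lia.
have [[A_ge0 A_le1] [B_ge0 B_le2]] := mod4_defect_bounds n q.
have [k hk] : exists k, n - 2 * k = odd_defect n.
  by have [k hk] := Z_modP n 2 erefl; exists k; rewrite /odd_defect; lia.
rewrite /capacity !Z.max_r in n_cap; [|rewrite /q; lia..].
have {}n_cap : 8 * 2 ^ Z.of_nat r <= n * t
    - odd_defect n * ((Z.of_nat r + 1) * Z.of_nat r) - 2 * mod4_defect n q * Z.of_nat r.
  by move: n_cap; rewrite -/t /q; lia.
have wY : zwins r.+1 (k, n - k, 0).
  have [b0 [b1 [hu hv hz]]] := second_imbalances (Z.of_nat r) n k ltac:(lia) hk.
  apply: (second_question_wins r n k (n - k) b0 b1) => //; rewrite -/q; try lia.
  have := Z.mul_le_mono_nonneg_l _ _ (Z.of_nat r) ltac:(lia) hz.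
  move: n_cap; rewrite -hk /weight /= /t /q; lia.
have wN : zwins r.+1 (n - k, k, 0).
  have [b0 [b1 [hu hv hz]]] :=
    second_imbalances_coarse (Z.of_nat r) (n - k) k ltac:(lia).
  have [A0|A1] : odd_defect n = 0 \/ odd_defect n = 1 by lia.
    by move: wY; rewrite (_ : n - k = k); last by lia.
  apply: (second_question_wins r n (n - k) k b0 b1) => //; rewrite -/q; try lia.
  have := Z.mul_le_mono_nonneg_l _ _ (Z.of_nat r) ltac:(lia) hz.
  have := Z.mul_nonneg_nonneg _ (Z.of_nat r) B_ge0 ltac:(lia).
  have : 2 * Z.of_nat r <= Z.of_nat r * Z.of_nat r
    by apply: Z.mul_le_mono_nonneg_r; lia.
  move: n_cap; rewrite -hk /weight /= /t /q; lia.
apply: (zwins_ask _ _ (k, 0, 0)).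
- by apply/and5P; split; [..|apply/andP; split] => /=; lia.
- by apply: zwins_mono wY => /=; lia.
- by apply: zwins_mono wN => /=; lia.
Qed.

Lemma zwins_of_capacity (q : nat) (n : Z) :
  2 * 2 ^ Z.of_nat q <= capacity n (Z.of_nat q) -> zwins q (n, 0, 0).
Proof.
have [lt_q|] := ltnP q 40; first exact: zwins_lt40.
case: q => [|[|r]] // q_ge hn.
set q := Z.of_nat r + 2; set t := q * q + q + 2.
have eq_q : Z.of_nat r.+2 = q by rewrite /q; lia.
rewrite eq_q in hn.
have t_gt : 2 * q < t by rewrite /t /q; nia.
have [n_le|n_gt] : (n - 3) * t <= 2 * 2 ^ q \/ 2 * 2 ^ q < (n - 3) * t by lia.
  exact: zwins_ge40.
(* The largest size that [zwins_ge40] admits; its surplus of chips outweighs the corrections for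
   every residue. *)
set n0 := 2 * 2 ^ q / t + 3.
have div_le := Z.mul_div_le (2 * 2 ^ q) t ltac:(lia).
have div_gt := Z.mul_succ_div_gt (2 * 2 ^ q) t ltac:(lia).
have n0_le : n0 <= n by rewrite /n0; nia.
apply: (zwins_mono _ n0 0 0) => //; apply: zwins_ge40 => //; rewrite -/q -/t.
- by rewrite /n0; lia.
- have [cap_ge _] := capacity_le n0 q ltac:(lia).
  by apply: Z.le_trans cap_ge; rewrite -/t /n0; lia.
Qed.

Local Close Scope Z_scope.
Local Open Scope ring_scope.

Theorem theorem14 (q n : nat) :
  paul_wins q (n, 0%N, 0%N) <->
  ((2 ^ q)%N%:Z <= (n * binom_le2 q)%N%:Z
                   - liarA n * ('C(q - 1, 2)%N)%:Z
                   - liarB n q * ('C(q - 2, 1)%N)%:Z).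
Proof.
rewrite capacityE; split; first exact: capacity_ge_pow.
by move/zwins_of_capacity; rewrite /zwins /nat_state /= Nat2Z.id.
Qed.
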